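(* Let $R$ be a commutative ring with identity, let $n\geq 2$, and let $f,g\in R[X]$ be monic polynomials of degree $n$ with companion matrices $C,D\in M_n(R)$, respectively. Then $R\langle C,D\rangle=M_n(R)$ if and only if the resultant $R(f,g)$ is a unit of $R$.
   Context: The companion matrix of a monic polynomial $f=f_0+f_1X+\cdots+f_{n-1}X^{n-1}+X^n\in R[X]$ is the matrix in $M_n(R)$ whose $j$-th column is $e_{j+1}$ for $1\leq j\leq n-1$ and whose last column is $(-f_0,-f_1,\dots,-f_{n-1})^t$, where $e_1,\dots,e_n$ is the canonical basis of the column space $R^n$. $R\langle C,D\rangle$ denotes the (unital) $R$-subalgebra of $M_n(R)$ generated by $C$ and $D$. $R(f,g)\in R$ denotes the resultant of $f$ and $g$. *)

(* Defs.v *)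
From mathcomp Require Import all_boot all_algebra.

Set Implicit Arguments.
Unset Strict Implicit.
Unset Printing Implicit Defensive.

Import GRing.Theory.
Local Open Scope ring_scope.

(* Column j < n.-1 is e_{j.+1} (0-based) and the last column holds the
   coefficients - f`_i.  This is the transpose of [companionmx] of mxpoly, with
   the dimension [n] given explicitly rather than as [(size f).-1]; it is meant
   for [f] monic with [size f = n.+1]. *)
Definition companion (R : nzRingType) (n : nat) (f : {poly R}) : 'M[R]_n :=
  \matrix_(i < n, j < n)
    if j == n.-1 :> nat then - f`_i else (i == j.+1 :> nat)%:R.

(* [subalg_closed] of ssralg only covers boolean predicates, whereas here
   subsets are arbitrary predicates in [Prop]. *)
Record subalgebra (R : nzRingType) (n : nat) (S : 'M[R]_n -> Prop) : Prop :=
  Subalgebra {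
    subalgebra1 : S 1%:M;
    subalgebraD : forall A B, S A -> S B -> S (A + B);
    subalgebraZ : forall (a : R) A, S A -> S (a *: A);
    subalgebraM : forall A B, S A -> S B -> S (A *m B) }.

Definition generated_subalgebra (R : nzRingType) (n : nat) (C D : 'M[R]_n) :
    'M[R]_n -> Prop :=
  fun A => forall S : 'M[R]_n -> Prop, subalgebra S -> S C -> S D -> S A.

(* Invertibility without a [unitRingType] structure, i.e. without assuming that
   it is decidable in [R]. *)
Definition is_unit (R : comNzRingType) (x : R) : Prop := exists y, x * y = 1.

(* Main.v *)
Require Import Defs.
From mathcomp Require Import all_boot all_algebra.
From mathcomp Require Import ring.

(** Identify [R^n] with the polynomials of degree less than [n].  Modulo [(f)]
    the companion matrix [C] of [f] is multiplication by ['X], so modulo the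
    ideal [(f, g)] both [C] and [D] are.  Hence every element of the algebra
    they generate acts modulo [(f, g)] as multiplication by a single polynomial
    [p].  If [e_1 e_n^T] does, then [p] is in [(f, g)] because [e_1] is killed
    ([n >= 2]), and [e_n |-> e_1] gives [1] in [(f, g)].  For monic [f] and [g]
    this makes the Sylvester matrix invertible.  Conversely, [C - D] is the
    rank one matrix [x |-> x_n (g - f)], and if [a f + b g = 1], then
    multiplying it on the left by [(b 'X^i)(C)] yields [e_i e_n^T]; multiplying
    the latter on the right by powers of [C] gives all the matrix units. *)

Set Implicit Arguments.
Unset Strict Implicit.
Unset Printing Implicit Defensive.

Import GRing.Theory.
Local Open Scope ring_scope.

Section Resultant.

Variables (R : comNzRingType) (f g : {poly R}).
Hypotheses (f_monic : f \is monic) (g_monic : g \is monic).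

(** Reduce [a] modulo [g] and let [b] absorb the quotient times [f]. Then [b' * g = p - a' * f] has
    bounded size, which bounds [b'] because [g] is monic. *)
Lemma monic_bezout_small (p : {poly R}) :
    (size p <= (size g).-1 + (size f).-1)%N ->
    (exists a b : {poly R}, a * f + b * g = p) ->
  exists a b : {poly R}, [/\ (size a <= (size g).-1)%N,
                             (size b <= (size f).-1)%N & a * f + b * g = p].
Proof.
move=> p_small [a [b ab_p]].
have [g_n0 f_n0] := (monic_neq0 g_monic, monic_neq0 f_monic).
pose a' := Pdiv.Ring.rmodp a g; pose b' := b + Pdiv.Ring.rdivp a g * f.
have a'_small : (size a' <= (size g).-1)%N.
  by rewrite -ltnS -polySpred // Pdiv.Ring.ltn_rmodpN0.
have a'b'_p : a' * f + b' * g = p.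
  rewrite -ab_p [in RHS](Pdiv.RingMonic.rdivp_eq g_monic a) /b' /a'.
  ring.
exists a', b'; split=> //.
have [-> | b'_n0] := eqVneq b' 0; first by rewrite size_poly0.
have b'gE : b' * g = p - a' * f by rewrite -a'b'_p addrC addKr.
suff : (size (b' * g)%R <= (size g).-1 + (size f).-1)%N.
  rewrite size_Mmonic // (polySpred g_n0) addnS /= addnC.
  by rewrite leq_add2l.
rewrite b'gE (leq_trans (size_polyD _ _)) // geq_max p_small size_polyN.
rewrite (leq_trans (size_polyMleq _ _)) // (polySpred f_n0) addnS /=.
by rewrite leq_add2r.
Qed.

(** The resultant always lies in the ideal of [f] and [g], whence a Bezout relation when it is a
    unit. Conversely, the coefficients of a small Bezout relation for ['X^k] form a row that the
    Sylvester matrix sends to the [k]-th basis row; stacking these rows gives a left inverse. *)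
Lemma monic_resultant_unit :
  (1 < size f)%N -> (1 < size g)%N ->
  is_unit (resultant f g) <-> exists a b : {poly R}, a * f + b * g = 1.
Proof.
move=> f_gt1 g_gt1; split=> [[y y_res] | [a [b ab1]]].
  have [[u v] /= _ uvE] := resultant_in_ideal f_gt1 g_gt1.
  exists (y%:P * u), (y%:P * v).
  by rewrite -!mulrA -mulrDr -uvE -polyCM mulrC y_res.
pose dS := ((size g).-1 + (size f).-1)%N.
(* Boolean equality lets [xchoose] pick the rows of [U] below. *)
have row_solve (k : 'I_dS) :
    exists u : 'rV_dS, u *m Sylvester_mx f g == delta_mx 0 k.
  have [||a' [b' [a'_small b'_small ab'E]]] := @monic_bezout_small 'X^k.
  - by rewrite size_polyXn ltn_ord.
  - exists ('X^k * a), ('X^k * b).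
    by rewrite -!mulrA -mulrDr ab1 mulr1.
  exists (row_mx (poly_rV a') (poly_rV b')); apply/eqP.
  rewrite /Sylvester_mx mul_row_col !mul_rV_lin1 /= !poly_rV_K //.
  rewrite -linearD /= ab'E.
  by apply: (can_inj rVpolyK); rewrite rVpoly_delta poly_rV_K ?size_polyXn.
pose U : 'M_dS := \matrix_k xchoose (row_solve k).
have US : U *m Sylvester_mx f g = 1%:M.
  apply/row_matrixP=> k; rewrite row_mul rowK rowE mulmx1.
  by apply/eqP; apply: (xchooseP (row_solve k)).
by exists (\det U); rewrite mulrC -det_mulmx US det1.
Qed.

End Resultant.

Section CompanionAction.

Variables (R : comNzRingType) (n : nat).
Implicit Types (f g p q : {poly R}) (A B : 'M[R]_n.+1) (x : 'cV[R]_n.+1).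

Definition cVpoly x : {poly R} := rVpoly x^T.

Lemma cVpolyD x y : cVpoly (x + y) = cVpoly x + cVpoly y.
Proof. by rewrite /cVpoly !linearD. Qed.

Lemma cVpolyZ c x : cVpoly (c *: x) = c *: cVpoly x.
Proof. by rewrite /cVpoly !linearZ. Qed.

Lemma cVpoly0 : cVpoly 0 = 0.
Proof. by rewrite /cVpoly !linear0. Qed.

Lemma cVpoly_delta (i : 'I_n.+1) : cVpoly (delta_mx i 0) = 'X^i.
Proof. by rewrite /cVpoly trmx_delta rVpoly_delta. Qed.

Lemma cVpoly_inj : injective cVpoly.
Proof. by move=> x y /(can_inj rVpolyK)/trmx_inj. Qed.

Lemma size_cVpoly x : (size (cVpoly x) <= n.+1)%N.
Proof. exact: size_poly. Qed.

(** Multiplication by ['X] shifts the entries; only the last one overflows, to degree [n.+1], where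
    the leading term of [f] cancels it. The identity is exact, not merely a congruence. *)
Lemma cVpoly_companion f x : f \is monic -> size f = n.+2 ->
  cVpoly (companion n.+1 f *m x) = 'X * cVpoly x - x ord_max 0 *: f.
Proof.
move=> f_monic f_deg.
have coefE (y : 'cV_n.+1) (k : 'I_n.+1) : (cVpoly y)`_k = y k 0.
  by rewrite /cVpoly coef_rVpoly_ord mxE.
have coef0 (y : 'cV_n.+1) k : (n < k)%N -> (cVpoly y)`_k = 0.
  by move=> lt_nk; rewrite nth_default // (leq_trans (size_cVpoly y)).
apply/polyP=> k; rewrite coefB coefXM coefZ.
have [lt_nk | le_kn] := ltnP n k.
  rewrite coef0 //; case: k lt_nk => //= k; rewrite ltnS leq_eqVlt.
  case/orP=> [/eqP<- | lt_nk].
    have := monicP f_monic; rewrite /lead_coef f_deg /= => ->.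
    by rewrite (coefE x ord_max) mulr1 subrr.
  by rewrite coef0 // nth_default ?f_deg // mulr0 subrr.
rewrite (coefE _ (Ordinal (le_kn : (k < n.+1)%N))) mxE big_ord_recr /=.
rewrite !mxE /= eqxx mulNr mulrC; congr (_ - _).
under eq_bigr => j _ do rewrite mxE /= ltn_eqF //.
case: k le_kn => [|k] lt_kn /=.
  by rewrite big1 // => j _; rewrite mul0r.
rewrite (bigD1 (Ordinal lt_kn)) //= eqxx mul1r big1 => [|j].
  by rewrite addr0 -(coefE x (widen_ord (leqnSn n) (Ordinal lt_kn))).
by rewrite -val_eqE /= eqSS eq_sym => /negPf->; rewrite mul0r.
Qed.

(** The multiplier [p] is the same for all [x], while [a] and [b] may vary with [x]. Taking [g] to
    be [0] gives congruence modulo [f] alone. *)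
Definition acts_mod f g p A : Prop := forall x, exists a b : {poly R},
  cVpoly (A *m x) = p * cVpoly x + (a * f + b * g).

Lemma acts_mod_scalar f g c : acts_mod f g c%:P c%:M.
Proof.
move=> x; exists 0, 0.
by rewrite mul_scalar_mx cVpolyZ mul_polyC !mul0r !addr0.
Qed.

Lemma acts_modD f g p q A B :
  acts_mod f g p A -> acts_mod f g q B -> acts_mod f g (p + q) (A + B).
Proof.
move=> pA qB x; have [a [b AE]] := pA x; have [a' [b' BE]] := qB x.
exists (a + a'), (b + b').
by rewrite mulmxDl cVpolyD AE BE !mulrDl addrACA [X in _ + X]addrACA.
Qed.

Lemma acts_modM f g p q A B :
  acts_mod f g p A -> acts_mod f g q B -> acts_mod f g (p * q) (A *m B).
Proof.
move=> pA qB x; have [a [b BE]] := qB x; have [a' [b' AE]] := pA (B *m x).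
exists (p * a + a'), (p * b + b').
by rewrite -mulmxA AE BE mulrDr mulrA -addrA !mulrDl mulrDr !mulrA addrACA.
Qed.

Lemma subalgebra_acts_mod f g :
  subalgebra (fun A => exists p, acts_mod f g p A).
Proof.
split; first by exists 1%:P; apply: acts_mod_scalar.
- by move=> A B [p pA] [q qB]; exists (p + q); apply: acts_modD.
- move=> c A [p pA]; exists (c%:P * p); rewrite -mul_scalar_mx.
  exact/acts_modM/pA/acts_mod_scalar.
- by move=> A B [p pA] [q qB]; exists (p * q); apply: acts_modM.
Qed.

Lemma acts_mod_companion f g : f \is monic -> size f = n.+2 ->
  acts_mod f g 'X (companion n.+1 f).
Proof.
move=> f_monic f_deg x; exists (- (x ord_max 0)%:P), 0.
by rewrite cVpoly_companion // mulNr mul0r addr0 mul_polyC.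
Qed.

Lemma acts_modC f g p A : acts_mod f g p A -> acts_mod g f p A.
Proof.
move=> pA x; have [a [b ->]] := pA x.
by exists b, a; rewrite [a * f + _]addrC.
Qed.

Lemma acts_mod_delta f g p : (0 < n)%N ->
    acts_mod f g p (delta_mx ord0 ord_max) ->
  exists a b : {poly R}, a * f + b * g = 1.
Proof.
move=> n_gt0 pE.
(* The first basis vector, which is killed, gives [p = - (a * f + b * g)]; the last one gives
   [1 = p * 'X^n + (a' * f + b' * g)]. *)
have [a [b]] := pE (delta_mx ord0 0); have [a' [b']] := pE (delta_mx ord_max 0).
rewrite mul_delta_mx mul_delta_mx_0 -?val_eqE /= -?lt0n // cVpoly0.
rewrite !cVpoly_delta !expr0 mulr1 => E1 /esym/eqP.
rewrite addr_eq0 => /eqP pE'; rewrite {}pE' in E1.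
exists (a' - a * 'X^n), (b' - b * 'X^n); rewrite {}E1.
ring.
Qed.

(** The matrix is [p] evaluated at the companion matrix, built by Horner's scheme. *)
Lemma subalgebra_acts_mod_exists (S : 'M[R]_n.+1 -> Prop) f p :
    f \is monic -> size f = n.+2 -> subalgebra S -> S (companion n.+1 f) ->
  exists2 A, S A & acts_mod f 0 p A.
Proof.
move=> f_monic f_deg algS SC.
have Sscalar c : S c%:M.
  by rewrite -scalemx1; apply: (subalgebraZ algS); apply: subalgebra1.
elim/poly_ind: p => [|p c [A SA pA]].
  by exists 0%:M => //; rewrite -polyC0; apply: acts_mod_scalar.
exists (A *m companion n.+1 f + c%:M).
  by apply: (subalgebraD algS) => //; apply: (subalgebraM algS).
apply: acts_modD; last exact: acts_mod_scalar.
exact/acts_modM/acts_mod_companion.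
Qed.

Lemma subalgebra_delta_last (S : 'M[R]_n.+1 -> Prop) f g (i : 'I_n.+1) :
    f \is monic -> size f = n.+2 -> g \is monic -> size g = n.+2 ->
    (exists a b : {poly R}, a * f + b * g = 1) ->
    subalgebra S -> S (companion n.+1 f) -> S (companion n.+1 g) ->
  S (delta_mx i ord_max).
Proof.
move=> f_monic f_deg g_monic g_deg [a [b ab1]] algS SC SD.
(* Modulo [f], [b * (g - f)] is [b * g], hence [1], so this multiplier sends [g - f] to ['X^i]. *)
have [A SA bA] := subalgebra_acts_mod_exists ('X^i * b) f_monic f_deg algS SC.
pose E := companion n.+1 f - companion n.+1 g.
suff <- : A *m E = delta_mx i ord_max.
  apply: (subalgebraM algS) => //; apply: (subalgebraD algS) => //.
  by rewrite -scaleN1r; apply: (subalgebraZ algS).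
have cEx x : cVpoly (E *m x) = x ord_max 0 *: (g - f).
  rewrite mulmxBl cVpolyD -scaleN1r cVpolyZ scaleN1r !cVpoly_companion //.
  by rewrite -!mul_polyC; ring.
suff AEx : forall x, A *m E *m x = x ord_max 0 *: delta_mx i 0.
  apply/trmx_inj/row_matrixP=> j.
  rewrite -!tr_col !colE AEx mul_delta_mx_cond mxE eqxx andbT.
  by rewrite scaler_nat.
move=> x; apply: cVpoly_inj; rewrite cVpolyZ cVpoly_delta -mulmxA.
have [c [d]] := bA (E *m x); rewrite [d * 0]mulr0 addr0 cEx => AExE.
have {}AExE : cVpoly (A *m (E *m x)) - x ord_max 0 *: 'X^i
            = (c - x ord_max 0 *: ('X^i * (a + b))) * f.
  rewrite AExE -!mul_polyC -[X in _ - _ * X]mulr1 -ab1.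
  ring.
have [c'0 | c'_n0] := eqVneq (c - x ord_max 0 *: ('X^i * (a + b))) 0.
  by apply/eqP; rewrite -subr_eq0 AExE c'0 mul0r.
(* A nonzero multiple of the monic [f] has size at least [n.+2], so the congruence modulo [f] is an
   equality. *)
suff : (size (cVpoly (A *m (E *m x)) - x ord_max 0 *: 'X^i)%R <= n.+1)%N.
  rewrite AExE size_Mmonic // f_deg addnS /= -[leqRHS]add0n leq_add2r.
  by rewrite leqn0 size_poly_eq0 (negPf c'_n0).
rewrite (leq_trans (size_polyD _ _)) // geq_max size_cVpoly size_polyN.
by rewrite (leq_trans (size_scale_leq _ _)) // size_polyXn ltn_ord.
Qed.

End CompanionAction.

Lemma subalgebra_full (R : comNzRingType) (n : nat) (S : 'M[R]_n.+1 -> Prop)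
    (f : {poly R}) :
    subalgebra S -> S (companion n.+1 f) ->
    (forall i, S (delta_mx i ord_max)) ->
  forall A, S A.
Proof.
move=> algS SC Slast A.
have S0 : S 0.
  by rewrite -(scale0r 1%:M); apply: (subalgebraZ algS); apply: subalgebra1.
have Sdelta k (i j : 'I_n.+1) : (j + k = n)%N -> S (delta_mx i j).
  elim: k j => [|k IHk] j jk.
    by rewrite (_ : j = ord_max) //; apply: val_inj; rewrite -[LHS]addn0 jk.
  have lt_jn : (j.+1 < n.+1)%N by rewrite ltnS -[ltnRHS]jk -addSnnS leq_addr.
  pose j' : 'I_n.+1 := Ordinal lt_jn.
  have -> : delta_mx i j = delta_mx i j' *m companion n.+1 f
                           + f`_j' *: delta_mx i ord_max :> 'M[R]_n.+1.
    apply/matrixP=> r s; rewrite !mxE (bigD1 j') //= big1 => [|t t_n].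
      rewrite !mxE eqxx addr0 andbT -!val_eqE /= eqSS [j == s :> nat]eq_sym.
      have [-> | s_n] := eqVneq (s : nat) n; last first.
        by rewrite andbF mulr0 addr0 -natrM mulnb.
      rewrite [n == j]gtn_eqF // andbF andbT.
      by rewrite mulrN [_%:R * _]mulrC addNr.
    by rewrite mxE (negPf t_n) andbF mul0r.
  apply: (subalgebraD algS).
    by apply: (subalgebraM algS) => //; apply: IHk; rewrite /= addSnnS.
  exact: (subalgebraZ algS).
rewrite (matrix_sum_delta A).
elim/big_ind: _ => [//|B B'|i _]; first exact: subalgebraD.
elim/big_ind: _ => [//|B B'|j _]; first exact: subalgebraD.
apply: (subalgebraZ algS); apply: (Sdelta (n - j)%N).
by rewrite subnKC // -ltnS.
Qed.

Theorem corollary5p2 (R : comNzRingType) (n : nat) (f g : {poly R})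
    (n_ge2 : (2 <= n)%N)
    (f_monic : f \is monic) (f_deg : size f = n.+1)
    (g_monic : g \is monic) (g_deg : size g = n.+1) :
  (forall A : 'M[R]_n,
     generated_subalgebra (companion n f) (companion n g) A)
  <-> is_unit (resultant f g).
Proof.
(* From here on the dimension is [n.+1], and [n_gt0], literally [2 <= n.+1], is convertible to
   [0 < n]. *)
case: n n_ge2 f_deg g_deg => [//|n] n_gt0 f_deg g_deg.
rewrite monic_resultant_unit ?f_deg ?g_deg //; split=> [gen | bezout A S].
  have [||p] := gen (delta_mx ord0 ord_max) _ (subalgebra_acts_mod n f g).
  - by exists 'X; apply: acts_mod_companion.
  - by exists 'X; apply/acts_modC/acts_mod_companion.
  exact: acts_mod_delta.
move=> algS SC SD; apply: (subalgebra_full algS SC) => i.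
exact: (subalgebra_delta_last i f_monic f_deg g_monic g_deg bezout).
Qed.
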